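(* Let $p$ be a prime, $\beta\ge 1$ an integer, $R=\mathbb{Z}_p[u,v]$, and let $\mathcal{C}$ be a cyclic code of length $\beta$ over $R$, regarded as an ideal of $R[x]/\langle x^\beta-1\rangle$. 1. If $\beta$ is not relatively prime to $p$, then at least one of the following holds: (a) there are $g,p_1,p_2\in\mathbb{Z}_p[x]$ with $\mathcal{C}=\langle g(x)+up_1(x)+vp_2(x)\rangle$ and $(g(x)+up_1(x)+vp_2(x))\mid (x^\beta-1)$ in $R[x]$; or (b) there are $g,a,b,p_1,p_2,p_3\in\mathbb{Z}_p[x]$ with $\mathcal{C}=\langle g(x)+up_1(x)+vp_2(x),\ ua(x)+vp_3(x),\ vb(x)\rangle$, where, in $\mathbb{Z}_p[x]$, $a(x)\mid g(x)\mid (x^\beta-1)$, $b(x)\mid g(x)\mid(x^\beta-1)$, $a(x)\mid p_1(x)\frac{x^\beta-1}{g(x)}$ and $b(x)\mid p_3(x)\frac{x^\beta-1}{a(x)}$. 2. If $\beta$ is relatively prime to $p$, then there are $g,a,b,p_1\in\mathbb{Z}_p[x]$ with $\mathcal{C}=\langle g(x)+ua(x)+vp_1(x),\ vb(x)\rangle$, where, in $\mathbb{Z}_p[x]$, $a(x)\mid g(x)\mid (x^\beta-1)$, $b(x)\mid g(x)\mid(x^\beta-1)$ and $b(x)\mid p_1(x)\frac{x^\beta-1}{a(x)}$.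
   Context: $\mathbb{Z}_p$ is the ring of integers modulo $p$. $R=\mathbb{Z}_p[u,v]$ denotes the ring $\mathbb{Z}_p+u\mathbb{Z}_p+v\mathbb{Z}_p$ of order $p^3$ with $u^2=v^2=uv=vu=0$. A linear code of length $\beta$ over $R$ is an $R$-submodule of $R^\beta$; it is cyclic if $(c_{\beta-1},c_0,\dots,c_{\beta-2})\in\mathcal{C}$ whenever $(c_0,\dots,c_{\beta-1})\in\mathcal{C}$. Identifying $(c_0,\dots,c_{\beta-1})$ with $c_0+c_1x+\dots+c_{\beta-1}x^{\beta-1}$, cyclic codes of length $\beta$ are exactly the ideals of $R[x]/\langle x^\beta-1\rangle$. $\langle\cdot\rangle$ denotes the ideal generated (polynomials are read modulo $x^\beta-1$). *)

(* Defs.v *)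
From HB Require Import structures.
From mathcomp Require Import all_boot all_order all_algebra.
From mathcomp Require Import ring.

Set Implicit Arguments.
Unset Strict Implicit.
Unset Printing Implicit Defensive.

Import GRing.Theory.
Local Open Scope ring_scope.

(* [Zpuv a b c] stands for a + u b + v c. *)
Record zpuv (p : nat) := Zpuv {
  zpuv_1 : 'F_p;
  zpuv_u : 'F_p;
  zpuv_v : 'F_p
}.
Arguments Zpuv {p}.

Section ZpuvRing.
Variable p : nat.
Local Notation R := (zpuv p).
Implicit Types x y z : R.

Definition triple_of_zpuv x := (zpuv_1 x, zpuv_u x, zpuv_v x).
Definition zpuv_of_triple (t : 'F_p * 'F_p * 'F_p) := Zpuv t.1.1 t.1.2 t.2.

Lemma triple_of_zpuvK : cancel triple_of_zpuv zpuv_of_triple.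
Proof. by case. Qed.

Lemma zpuv_of_tripleK : cancel zpuv_of_triple triple_of_zpuv.
Proof. by case=> [[]]. Qed.

HB.instance Definition _ := Equality.copy R (can_type triple_of_zpuvK).
HB.instance Definition _ := Choice.copy R (can_type triple_of_zpuvK).
HB.instance Definition _ := Countable.copy R (can_type triple_of_zpuvK).
HB.instance Definition _ : isFinite R := CanIsFinite triple_of_zpuvK.

Definition zpuv_zero : R := Zpuv 0 0 0.
Definition zpuv_one : R := Zpuv 1 0 0.
Definition zpuv_opp x : R := Zpuv (- zpuv_1 x) (- zpuv_u x) (- zpuv_v x).
Definition zpuv_add x y : R :=
  Zpuv (zpuv_1 x + zpuv_1 y) (zpuv_u x + zpuv_u y) (zpuv_v x + zpuv_v y).

(* Expand bilinearly and use u^2 = v^2 = uv = vu = 0. *)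
Definition zpuv_mul x y : R :=
  Zpuv (zpuv_1 x * zpuv_1 y)
       (zpuv_1 x * zpuv_u y + zpuv_u x * zpuv_1 y)
       (zpuv_1 x * zpuv_v y + zpuv_v x * zpuv_1 y).

Fact zpuv_addA : associative zpuv_add.
Proof. by move=> x y z; congr Zpuv; rewrite addrA. Qed.
Fact zpuv_addC : commutative zpuv_add.
Proof. by move=> x y; congr Zpuv; rewrite addrC. Qed.
Fact zpuv_add0 : left_id zpuv_zero zpuv_add.
Proof. by case=> a b c; congr Zpuv; rewrite add0r. Qed.
Fact zpuv_addN : left_inverse zpuv_zero zpuv_opp zpuv_add.
Proof. by move=> x; congr Zpuv; rewrite addNr. Qed.

HB.instance Definition _ :=
  GRing.isZmodule.Build R zpuv_addA zpuv_addC zpuv_add0 zpuv_addN.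

Fact zpuv_mulA : associative zpuv_mul.
Proof. by move=> x y z; congr Zpuv => /=; ring. Qed.
Fact zpuv_mulC : commutative zpuv_mul.
Proof. by move=> x y; congr Zpuv => /=; ring. Qed.
Fact zpuv_mul1 : left_id zpuv_one zpuv_mul.
Proof. by case=> a b c; congr Zpuv => /=; ring. Qed.
Fact zpuv_mulDl : left_distributive zpuv_mul +%R.
Proof. by move=> x y z; congr Zpuv => /=; ring. Qed.
Fact zpuv_one_neq0 : zpuv_one != 0.
Proof. by apply/eqP => -[] /eqP; rewrite oner_eq0. Qed.

HB.instance Definition _ := GRing.Zmodule_isComNzRing.Build R
  zpuv_mulA zpuv_mulC zpuv_mul1 zpuv_mulDl zpuv_one_neq0.

Definition ru : R := Zpuv 0 1 0.
Definition rv : R := Zpuv 0 0 1.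
Definition zpuvC (a : 'F_p) : R := Zpuv a 0 0.

Fact zpuvC_is_zmod_morphism : zmod_morphism zpuvC.
Proof. by move=> a b; congr Zpuv => /=; ring. Qed.
HB.instance Definition _ :=
  GRing.isZmodMorphism.Build 'F_p R zpuvC zpuvC_is_zmod_morphism.

Fact zpuvC_is_monoid_morphism : monoid_morphism zpuvC.
Proof. by split=> // a b; congr Zpuv => /=; ring. Qed.
HB.instance Definition _ :=
  GRing.isMonoidMorphism.Build 'F_p R zpuvC zpuvC_is_monoid_morphism.

Lemma zpuvE x :
  x = zpuvC (zpuv_1 x) + ru * zpuvC (zpuv_u x) + rv * zpuvC (zpuv_v x).
Proof. by case: x => a b c; congr Zpuv => /=; ring. Qed.

Lemma zpuv_rels : [/\ ru ^+ 2 = 0, rv ^+ 2 = 0, ru * rv = 0 & rv * ru = 0].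
Proof. by split; congr Zpuv => /=; ring. Qed.

Lemma card_zpuv : prime p -> #|{: R}| = (p ^ 3)%N.
Proof.
move=> p_pr; rewrite (bij_eq_card (Bijective triple_of_zpuvK zpuv_of_tripleK)).
by rewrite !card_prod card_Fp // !expnS expn0 muln1 mulnA.
Qed.

End ZpuvRing.

Arguments ru {p}.
Arguments rv {p}.

(* The polynomial g + u a + v b of R[x], for g, a, b in Z_p[x]. *)
Definition uvpoly (p : nat) (g a b : {poly 'F_p}) : {poly zpuv p} :=
  map_poly (@zpuvC p) g + ru *: map_poly (@zpuvC p) a
                        + rv *: map_poly (@zpuvC p) b.

Definition ideal_gen (A : comNzRingType) (s : seq A) (f : A) : Prop :=
  exists k : 'I_(size s) -> A, f = \sum_(i < size s) k i * s`_i.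

(* Divisibility in R[x] for a commutative ring R that need not be a domain; the
   boolean relations of polydiv are based on pseudo-division. *)
Definition poly_divides (R : comNzRingType) (f h : {poly R}) : Prop :=
  exists q : {poly R}, h = f * q.

Section CyclicCodes.
Variables (R : finComNzRingType) (n : nat).
Implicit Types (c : 'rV[R]_n) (C : {set 'rV[R]_n}).

(* (c_0, c_1, ..., c_(n-1)) |-> (c_(n-1), c_0, ..., c_(n-2)) *)
Definition cshift c : 'rV[R]_n := \row_j c 0 (ord_pred j).

Definition linear_code C : Prop := submod_closed (mem C).

Definition cyclic_code C : Prop :=
  linear_code C /\ (forall c, c \in C -> cshift c \in C).

(* {poly %/ h} is the quotient by h only when h is monic of size > 1; for
   h = x^n - 1 this means n >= 1. *)
Definition cyc_modulus : {poly R} := 'X^n - 1.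

(* [rVpoly c] is c_0 + c_1 x + ... + c_(n-1) x^(n-1). *)
Definition code_poly c : {poly %/ cyc_modulus} :=
  in_qpoly cyc_modulus (rVpoly c).

Definition code_ideal C : {set {poly %/ cyc_modulus}} :=
  [set code_poly c | c in C].

(* C = <s>, the polynomials in s being read modulo x^n - 1. *)
Definition code_generated_by C (s : seq {poly R}) : Prop :=
  forall f : {poly %/ cyc_modulus},
    f \in code_ideal C <-> ideal_gen [seq in_qpoly cyc_modulus q | q <- s] f.

End CyclicCodes.

(* Main.v *)
(** Lift the code to the ideal I of R[x] consisting of the polynomials whose
    class modulo m = x^beta - 1 lies in C. Since Z_p[x] is principal, there are
    g generating the constant components of the elements of I, a generating the
    u-components of the elements of I with no constant component, and b
    generating the f with v f in I. Lifting g and ua to elements of I gives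
    three generators; all the divisibilities come from m, u m, u (g + ...) and
    v (g + ...) lying in I. So case (b) always occurs in part 1.

    If beta is prime to p then m is separable, so g is coprime to h = m / g. As
    a | p1 h and a | g, a divides p1, and g itself lies in I after reducing by
    the other two generators. Put f = g + ua + vp3. With s g + t h = 1,
    ua + vp3 = t (h f - m) + s a (u f) + s p3 (v f), so f and vb generate. *)
Require Import Defs.
From mathcomp Require Import all_boot all_order all_algebra.
From mathcomp Require Import separable cyclotomic ring.
From Stdlib Require Import Classical.

Set Implicit Arguments.
Unset Strict Implicit.
Unset Printing Implicit Defensive.

Import GRing.Theory.
Local Open Scope ring_scope.

(** * Ideals of a commutative ring, and principality of [{poly F}] *)

Section Ideals.
Variable A : comNzRingType.

Definition is_ideal (I : A -> Prop) : Prop :=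
  [/\ I 0, forall x y, I x -> I y -> I (x + y) & forall k x, I x -> I (k * x)].

Lemma ideal_gen_is_ideal (s : seq A) : is_ideal (ideal_gen s).
Proof.
split=> [|x y [k ->] [l ->]|c x [k ->]].
- by exists (fun=> 0); rewrite big1 // => i _; rewrite mul0r.
- exists (fun i => k i + l i); rewrite -big_split /=.
  by apply: eq_bigr => i _; rewrite mulrDl.
- exists (fun i => c * k i); rewrite mulr_sumr.
  by apply: eq_bigr => i _; rewrite mulrA.
Qed.

Lemma mem_ideal_gen (s : seq A) x : x \in s -> ideal_gen s x.
Proof.
move=> xs; have lt_xs : (index x s < size s)%N by rewrite index_mem.
exists (fun i => (i == Ordinal lt_xs)%:R).
rewrite (bigD1 (Ordinal lt_xs)) //= eqxx mul1r nth_index // big1 ?addr0 //.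
by move=> i /negPf ->; rewrite mul0r.
Qed.

Lemma ideal_gen_sub (s : seq A) (I : A -> Prop) :
  is_ideal I -> (forall x, x \in s -> I x) -> forall x, ideal_gen s x -> I x.
Proof.
case=> I0 ID IM sI _ [k ->].
by apply: big_ind => // i _; apply/IM/sI/mem_nth.
Qed.

End Ideals.

Lemma is_ideal_preim (A B : comNzRingType) (f : {rmorphism A -> B})
    (I : B -> Prop) :
  is_ideal I -> is_ideal (fun x => I (f x)).
Proof.
case=> I0 ID IM; split=> [|x y|k x]; rewrite ?rmorph0 // ?rmorphD ?rmorphM.
  exact: ID.
exact: IM.
Qed.

(** Descent on the size of [d]: if [d] fails to divide some [f] in [I], then [f %% d] is a smaller
    nonzero element of [I]. Membership in [I] is a mere proposition, so the case split is
    classical. *)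
Lemma poly_ideal_principal (F : fieldType) (I : {poly F} -> Prop) d :
  is_ideal I -> d != 0 -> I d -> exists2 g, I g & forall f, I f -> g %| f.
Proof.
case=> _ ID IM; have [n] := ubnP (size d).
elim: n d => // n IHn d; rewrite ltnS => le_dn d_neq0 Id.
have [[f [If nd_f]]|min_d] := classic (exists f, I f /\ ~~ (d %| f)); last first.
  by exists d => // f If; apply: contraT => nd_f; case: min_d; exists f.
apply: (IHn (f %% d)) => //.
- by rewrite (leq_trans _ le_dn) // ltn_modp.
- have -> : f %% d = f + (- (f %/ d)) * d.
    by apply/esym/eqP; rewrite mulNr subr_eq addrC -divp_eq.
  by apply: ID => //; apply: IM.
Qed.

(** * Arithmetic of [g + ua + vb], and ideals of [R[x]] *)

Section UVPoly.
Variable p : nat.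
Implicit Types (x y z : {poly 'F_p}) (I : {poly zpuv p} -> Prop).

Lemma uvpolyD x y z x' y' z' :
  uvpoly x y z + uvpoly x' y' z' = uvpoly (x + x') (y + y') (z + z').
Proof. rewrite /uvpoly !rmorphD /= !scalerDr; ring. Qed.

Lemma uvpolyM x y z x' y' z' :
  uvpoly x y z * uvpoly x' y' z'
  = uvpoly (x * x') (x * y' + y * x') (x * z' + z * x').
Proof.
have [uu vv uv _] := zpuv_rels p.
have UU : (ru%:P : {poly zpuv p}) * ru%:P = 0 by rewrite -polyCM -expr2 uu.
have VV : (rv%:P : {poly zpuv p}) * rv%:P = 0 by rewrite -polyCM -expr2 vv.
have UV : (ru%:P : {poly zpuv p}) * rv%:P = 0 by rewrite -polyCM uv.
rewrite /uvpoly !rmorphD !rmorphM /= -!mul_polyC.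
set X := map_poly _ x; set Y := map_poly _ y; set Z := map_poly _ z.
set X' := map_poly _ x'; set Y' := map_poly _ y'; set Z' := map_poly _ z'.
ring: UU VV UV.
Qed.

Lemma uvpoly_surj (f : {poly zpuv p}) : exists x y z, f = uvpoly x y z.
Proof.
pose comp (c : zpuv p -> 'F_p) := \poly_(i < size f) c f`_i.
exists (comp (@zpuv_1 p)), (comp (@zpuv_u p)), (comp (@zpuv_v p)).
apply/polyP => i; rewrite /uvpoly !coefD !coefZ !coef_map !coef_poly.
case: ltnP => [_|le_fi]; first exact: zpuvE.
by rewrite !raddf0 !mulr0 !addr0 nth_default.
Qed.

Lemma uvpoly_Xn_sub_1 n : uvpoly ('X^n - 1) 0 0 = 'X^n - 1 :> {poly zpuv p}.
Proof.
by rewrite /uvpoly !raddf0 !addr0 rmorphB /= map_polyXn rmorph1.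
Qed.

Lemma uv_idealD I x y z x' y' z' : is_ideal I ->
  I (uvpoly x y z) -> I (uvpoly x' y' z') ->
  I (uvpoly (x + x') (y + y') (z + z')).
Proof. by case=> _ ID _ ? ?; rewrite -uvpolyD; apply: ID. Qed.

Lemma uv_idealM I k x y z : is_ideal I ->
  I (uvpoly x y z) -> I (uvpoly (k * x) (k * y) (k * z)).
Proof.
case=> _ _ IM /(IM (uvpoly k 0 0)).
by rewrite uvpolyM !mul0r !addr0.
Qed.

(** Multiplication by [u] kills the [u]- and [v]-components and moves the constant one into the
    [u]-slot. *)
Lemma uv_ideal_u I x y z : is_ideal I -> I (uvpoly x y z) -> I (uvpoly 0 x 0).
Proof.
case=> _ _ IM /(IM (uvpoly 0 1 0)).
by rewrite uvpolyM !mul0r !addr0 add0r mul1r.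
Qed.

Lemma uv_ideal_v I x y z : is_ideal I -> I (uvpoly x y z) -> I (uvpoly 0 0 x).
Proof.
case=> _ _ IM /(IM (uvpoly 0 0 1)).
by rewrite uvpolyM !mul0r !addr0 add0r mul1r.
Qed.

Lemma uvpoly0 : uvpoly 0 0 0 = 0 :> {poly zpuv p}.
Proof. by rewrite /uvpoly !raddf0 !addr0. Qed.

(** Each of the three sets of leading components is an ideal of [Z_p[x]]; it contains [m], because
    [m], [um] and [vm] lie in [I], so it is principal. The [p1], [p2], [p3] are whatever components
    accompany the generators. *)
Lemma uv_ideal_basis I m : is_ideal I -> m != 0 -> I (uvpoly m 0 0) ->
  exists g a b p1 p2 p3,
    [/\ I (uvpoly g p1 p2), I (uvpoly 0 a p3) & I (uvpoly 0 0 b)] /\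
    [/\ forall x y z, I (uvpoly x y z) -> g %| x,
        forall y z, I (uvpoly 0 y z) -> a %| y
      & forall z, I (uvpoly 0 0 z) -> b %| z].
Proof.
move=> idI m_neq0 Im; have I0 : I (uvpoly 0 0 0) by rewrite uvpoly0; case: idI.
have [||g [p1 [p2 Ig]] g_min] :=
    @poly_ideal_principal _ (fun x => exists y z, I (uvpoly x y z)) m _ m_neq0.
- split=> [|x x' [y [z Ix]] [y' [z' Ix']]|k x [y [z Ix]]].
  + by exists 0, 0.
  + by do 2!eexists; apply: uv_idealD Ix Ix'.
  + by do 2!eexists; apply: uv_idealM Ix.
- by exists 0, 0.
have [||a [p3 Ia] a_min] :=
    @poly_ideal_principal _ (fun y => exists z, I (uvpoly 0 y z)) m _ m_neq0.
- split=> [|y y' [z Iy] [z' Iy']|k y [z Iy]].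
  + by exists 0.
  + by eexists; rewrite -[X in uvpoly X](addr0 0); apply: uv_idealD Iy Iy'.
  + by eexists; rewrite -(mulr0 k); apply: uv_idealM Iy.
- by exists 0; apply: uv_ideal_u Im.
have [||b Ib b_min] :=
    @poly_ideal_principal _ (fun z => I (uvpoly 0 0 z)) m _ m_neq0.
- split=> // [z z' Iz Iz'|k z Iz].
  + by rewrite -(addr0 0); apply: uv_idealD.
  + by rewrite -(mulr0 k); apply: uv_idealM.
- exact: uv_ideal_v Im.
exists g, a, b, p1, p2, p3; do 2!split=> //.
  by move=> x y z Ix; apply: g_min; exists y, z.
by move=> y z Iy; apply: a_min; exists z.
Qed.

End UVPoly.

(** * From cyclic codes to ideals of [R[x]] *)

Section CyclicCodes.
Variables (R : finComNzRingType) (n : nat) (C : {set 'rV[R]_n}).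
Hypotheses (n_gt0 : (0 < n)%N) (C_cyclic : cyclic_code C).
Local Notation M := (cyc_modulus R n).

Lemma monic_cyc_modulus : M \is monic.
Proof. by rewrite /cyc_modulus -polyC1 monicXnsubC. Qed.

Lemma size_cyc_modulus : size M = n.+1.
Proof. by rewrite /cyc_modulus -polyC1 size_XnsubC. Qed.

(** The quotient type reduces modulo [mk_monic M], which defaults to ['X] when [M] is not monic of
    size above 1; [n_gt0] excludes this. *)
Lemma mk_monic_cyc_modulus : mk_monic M = M.
Proof. by rewrite /mk_monic size_cyc_modulus ltnS n_gt0 monic_cyc_modulus. Qed.

Lemma in_qpoly_modulus : in_qpoly M M = 0.
Proof.
apply: val_inj; rewrite /= mk_monic_cyc_modulus.
exact/Pdiv.RingMonic.rmodpp/monic_cyc_modulus.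
Qed.

Lemma in_qpoly_surj (f : {poly %/ M}) : in_qpoly M (val f) = f.
Proof. exact/val_inj/in_qpoly_small/size_mk_monic. Qed.

(** As polynomials, [x c(x)] and the shifted word differ by [c_(n-1)] times [x^n - 1]. *)
Lemma code_polyX (c : 'rV[R]_n) :
  in_qpoly M 'X * code_poly c = code_poly (cshift c).
Proof.
have lt_n1n : (n.-1 < n)%N by rewrite prednK.
rewrite /code_poly -rmorphM /=; apply/eqP; rewrite -subr_eq0 -rmorphB /=.
suff -> : 'X * rVpoly c - rVpoly (cshift c) = (c 0 (Ordinal lt_n1n))%:P * M.
  by rewrite rmorphM /= in_qpoly_modulus mulr0.
apply/polyP => i; rewrite coefB coefXM coefCM coefB coefXn coef1.
(* Coefficients cancel for [0 < i < n] and vanish for [i > n]; [i = 0] carries the wrapped-around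
   entry and [i = n] the overflow. *)
have [lt_in|le_ni] := ltnP i n.
  rewrite (coef_rVpoly_ord _ (Ordinal lt_in)) mxE (ltn_eqF lt_in) sub0r.
  case: i lt_in => [|i] lt_in /=.
    rewrite sub0r mulrN1; congr (- c 0 _).
    by apply: val_inj; rewrite /= add0n modn_small.
  rewrite mulrN mulr0 oppr0 (coef_rVpoly_ord _ (Ordinal (ltnW lt_in))).
  apply/eqP; rewrite subr_eq0; apply/eqP; congr (c 0 _); apply: val_inj => /=.
  by rewrite modnDr modn_small // ltnW.
have -> : (rVpoly (cshift c))`_i = 0.
  by rewrite coef_rVpoly insubF // ltnNge le_ni.
rewrite -(prednK (leq_trans n_gt0 le_ni)) /= !subr0.
have [->|neq_in] := eqVneq i n.
  by rewrite prednK // eqxx mulr1 (coef_rVpoly_ord _ (Ordinal lt_n1n)).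
rewrite prednK ?(leq_trans n_gt0) // (negPf neq_in) mulr0 coef_rVpoly insubF //.
apply/negbTE; rewrite -leqNgt -ltnS prednK ?(leq_trans n_gt0) //.
by rewrite ltn_neqAle eq_sym neq_in.
Qed.

Lemma code_ideal_is_ideal : is_ideal (fun f => f \in code_ideal C).
Proof.
have [[C0 CZD] Cshift] := C_cyclic.
have I0 : 0 \in code_ideal C.
  by apply/imsetP; exists 0; rewrite // /code_poly !raddf0.
have IZD a f g : f \in code_ideal C -> g \in code_ideal C ->
    a *: f + g \in code_ideal C.
  move=> /imsetP[c cC ->] /imsetP[d dC ->]; apply/imsetP; exists (a *: c + d).
    exact: CZD.
  by rewrite /code_poly !linearP.
have ID f g : f \in code_ideal C -> g \in code_ideal C ->
    f + g \in code_ideal C.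
  by move=> If Ig; rewrite -[f]scale1r; apply: IZD.
(* Horner induction on the multiplier: a factor [x] is a cyclic shift, a constant factor is a
   scaling. *)
split=> // k f If; rewrite -[k]in_qpoly_surj.
elim/poly_ind: (val k) => [|q a IHq]; first by rewrite raddf0 mul0r.
rewrite rmorphD rmorphM /= mulrDl; apply: ID.
  rewrite [_ q * _]mulrC -mulrA; case/imsetP: IHq => c cC ->.
  by rewrite code_polyX; apply: imset_f; apply: Cshift.
rewrite -[a%:P]mulr1 mul_polyC linearZ /= rmorph1 -scalerAl mul1r.
rewrite -[_ *: _]addr0.
exact: IZD.
Qed.

Definition code_poly_ideal (f : {poly R}) : Prop :=
  in_qpoly M f \in code_ideal C.

Lemma code_poly_ideal_is_ideal : is_ideal code_poly_ideal.
Proof. exact: (is_ideal_preim (in_qpoly M) code_ideal_is_ideal). Qed.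

Lemma code_poly_ideal_modulus : code_poly_ideal M.
Proof.
by rewrite /code_poly_ideal in_qpoly_modulus; case: code_ideal_is_ideal.
Qed.

(** Moves generation from the quotient to [R[x]]: the second hypothesis is applied to the preimage
    of the ideal generated by the classes of [s]. *)
Lemma code_generated_byP (s : seq {poly R}) :
  (forall q, q \in s -> code_poly_ideal q) ->
  (forall J : {poly R} -> Prop, is_ideal J -> J M ->
     (forall q, q \in s -> J q) -> forall f, code_poly_ideal f -> J f) ->
  code_generated_by C s.
Proof.
move=> sC C_min f; split=> [Cf|]; last first.
  apply: (ideal_gen_sub code_ideal_is_ideal) => _ /mapP[q qs ->]; exact: sC.
rewrite -(in_qpoly_surj f).
pose gen := ideal_gen [seq in_qpoly M q | q <- s].
have id_gen : is_ideal gen := ideal_gen_is_ideal _.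
apply: (C_min (fun f => gen (in_qpoly M f))).
- exact: (is_ideal_preim (in_qpoly M) id_gen).
- by rewrite in_qpoly_modulus; case: id_gen.
- by move=> q qs; apply/mem_ideal_gen/map_f.
- by rewrite /code_poly_ideal in_qpoly_surj.
Qed.

End CyclicCodes.

(** Since [n] is nonzero in [Z_p], [x^n - 1] is separable, and complementary factors of a separable
    polynomial are coprime. *)
Lemma coprimep_Xn_sub_1 (p n : nat) (g : {poly 'F_p}) : prime p ->
  coprime n p -> g %| 'X^n - 1 -> coprimep g (('X^n - 1) %/ g).
Proof.
move=> p_pr co_np dv_gm; apply: (@separable_coprime _ ('X^n - 1)).
  apply: separable_Xn_sub_1; rewrite -(dvdn_pcharf (pchar_Fp p_pr)).
  by rewrite -prime_coprime // coprime_sym.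
by rewrite mulrC divpK.
Qed.

(** * Generators of a cyclic code *)

Unset Implicit Arguments.

Theorem theorem2 (p beta : nat) (p_pr : prime p) (beta_gt0 : (0 < beta)%N)
    (C : {set 'rV[zpuv p]_beta}) (C_cyclic : cyclic_code C) :
  (~~ coprime beta p ->
     (exists g p1 p2 : {poly 'F_p},
        code_generated_by C [:: uvpoly g p1 p2]
        /\ poly_divides (uvpoly g p1 p2) ('X^beta - 1))
     \/
     (exists g a b p1 p2 p3 : {poly 'F_p},
        code_generated_by C [:: uvpoly g p1 p2; uvpoly 0 a p3; uvpoly 0 0 b]
        /\ [/\ a %| g, b %| g & g %| 'X^beta - 1]
        /\ a %| p1 * (('X^beta - 1) %/ g)
        /\ b %| p3 * (('X^beta - 1) %/ a)))
  /\
  (coprime beta p ->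
     exists g a b p1 : {poly 'F_p},
        code_generated_by C [:: uvpoly g a p1; uvpoly 0 0 b]
        /\ [/\ a %| g, b %| g & g %| 'X^beta - 1]
        /\ b %| p1 * (('X^beta - 1) %/ a)).
Proof.
set m : {poly 'F_p} := 'X^beta - 1.
have m_neq0 : m != 0 by rewrite -size_poly_eq0 size_XnsubC.
have mE : uvpoly m 0 0 = cyc_modulus (zpuv p) beta by apply: uvpoly_Xn_sub_1.
have idI := code_poly_ideal_is_ideal beta_gt0 C_cyclic.
have Im := code_poly_ideal_modulus beta_gt0 C_cyclic.
have genP := code_generated_byP beta_gt0 C_cyclic.
move: (code_poly_ideal C) idI Im genP => I idI; rewrite -mE => Im genP.
have [g [a [b [p1 [p2 [p3 [[Ig Ia Ib] [g_min a_min b_min]]]]]]]] :=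
  uv_ideal_basis idI m_neq0 Im.
have dv_gm : g %| m by apply: g_min Im.
have dv_ag : a %| g by apply/a_min/(uv_ideal_u idI Ig).
have dv_bg : b %| g by apply/b_min/(uv_ideal_v idI Ig).
have dv_am := dvdp_trans dv_ag dv_gm.
pose h := m %/ g; have hg : h * g = m by rewrite divpK.
(* Subtracting [m] from [h (g + u p1 + v p2)] cancels the constant component. *)
have Ihp : I (uvpoly 0 (h * p1) (h * p2)).
  have := uv_idealD idI (uv_idealM h idI Ig) (uv_idealM (- 1) idI Im).
  by rewrite hg !mulr0 !addr0 mulN1r subrr.
have dv_ap1 : a %| p1 * h by rewrite mulrC; apply: a_min Ihp.
have dv_bp3 : b %| p3 * (m %/ a).
  apply: b_min; have := uv_idealD idI (uv_idealM (m %/ a) idI Ia)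
    (uv_idealM (- 1) idI (uv_ideal_u idI Im)).
  by rewrite divpK // !mulr0 !addr0 mulN1r subrr mulrC.
(* Divisions by [g], [a], [b] clear the components of [f] in turn; the quotients [k], [l], [r] then
   rebuild [f] inside [J]. *)
have span J : is_ideal J -> J (uvpoly g p1 p2) -> J (uvpoly 0 a p3) ->
    J (uvpoly 0 0 b) -> forall f, I f -> J f.
  move=> idJ Jg Ja Jb f; have [x [y [z ->]]] := uvpoly_surj f => If.
  have /dvdpP[k x_kg] := g_min _ _ _ If.
  have := uv_idealD idI If (uv_idealM (- k) idI Ig).
  rewrite x_kg [- k * g]mulNr subrr => If1.
  have /dvdpP[l y_la] := a_min _ _ If1.
  have := uv_idealD idI If1 (uv_idealM (- l) idI Ia).
  rewrite y_la [- l * a]mulNr subrr mulr0 addr0 => /b_min/dvdpP[r z_rb].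
  have := uv_idealD idJ (uv_idealM k idJ Jg)
    (uv_idealD idJ (uv_idealM l idJ Ja) (uv_idealM r idJ Jb)).
  rewrite -y_la -z_rb !mulr0 !addr0.
  by congr (J (uvpoly _ _ _)); ring.
split=> [_|co_bp].
  right; exists g, a, b, p1, p2, p3; split=> //; apply: genP.
    by move=> q; rewrite !inE => /or3P[] /eqP->.
  by move=> J idJ _ sJ f; apply: span => //; apply: sJ; rewrite !inE eqxx ?orbT.
have co_gh : coprimep g h := coprimep_Xn_sub_1 p_pr co_bp dv_gm.
have [[s t] /= bez] := Bezout_eq1_coprimepP _ _ co_gh.
have /dvdpP[k p1_ka] : a %| p1.
  by rewrite -(Gauss_dvdpl _ (coprimep_dvdr dv_ag co_gh)).
(* Subtracting [k h (ua + v p3)] from [u h p1 + v h p2] leaves [v h (p2 - k p3)], and [h] is coprime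
   to [b]. *)
have /dvdpP[l p2_lb] : b %| p2 - k * p3.
  rewrite -(Gauss_dvdpr _ (coprimep_dvdr dv_bg co_gh)); apply: b_min.
  have := uv_idealD idI Ihp (uv_idealM (- (k * h)) idI Ia).
  by congr (I (uvpoly _ _ _)); rewrite ?p1_ka; ring.
have Ig0 : I (uvpoly g 0 0).
  have := uv_idealD idI Ig
    (uv_idealD idI (uv_idealM (- k) idI Ia) (uv_idealM (- l) idI Ib)).
  by rewrite [- l * b]mulNr -p2_lb p1_ka; congr (I (uvpoly _ _ _)); ring.
(* The first generator [g + ua + v p3] is the sum of [g] and [ua + v p3], both in [I]. *)
exists g, a, b, p3; split=> //; apply: genP => [q|J idJ Jm sJ].
  rewrite !inE => /orP[] /eqP-> //.
  by have := uv_idealD idI Ig0 Ia; rewrite addr0 !add0r.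
have Jf : J (uvpoly g a p3) by apply: sJ; rewrite !inE eqxx.
have Jb : J (uvpoly 0 0 b) by apply: sJ; rewrite !inE eqxx orbT.
have Ja : J (uvpoly 0 a p3).
  have Jhf := uv_idealD idJ (uv_idealM h idJ Jf) (uv_idealM (- 1) idJ Jm).
  have Jsg := uv_idealD idJ (uv_idealM (s * a) idJ (uv_ideal_u idJ Jf))
    (uv_idealM (s * p3) idJ (uv_ideal_v idJ Jf)).
  have := uv_idealD idJ (uv_idealM t idJ Jhf) Jsg.
  congr (J (uvpoly _ _ _)); first by rewrite hg; ring.
    by rewrite -[RHS]mul1r -bez; ring.
  by rewrite -[RHS]mul1r -bez; ring.
apply: span => //.
(* [Jf] minus [Ja] is [g]; adding [k (ua + v p3) + l v b] restores [g + u p1 + v p2]. *)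
have := uv_idealD idJ (uv_idealD idJ Jf (uv_idealM (- 1) idJ Ja))
  (uv_idealD idJ (uv_idealM k idJ Ja) (uv_idealM l idJ Jb)).
by rewrite -p2_lb -p1_ka; congr (J (uvpoly _ _ _)); ring.
Qed.
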